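(* Let $\mathcal{E}$ be a Euclidean vector space with inner product $\langle\cdot,\cdot\rangle$, $C$ a nonempty closed subset of $\mathcal{E}$, $R$ a retraction on $C$, $f : \mathcal{E} \to \mathbb{R}$ a continuously differentiable function, and $\beta, c \in (0,1)$. Let $x \in C$ be a point that is not B-stationary for the problem $\min_{y \in C} f(y)$, and let $v \in T_C(x)$ be such that $\langle \nabla f(x), v\rangle < 0$. Then there exists $\alpha_* \in (0,\infty)$ such that, for all $t \in [0,\alpha_*]$, the Armijo condition $$f(R(x,tv)) \le f(x) + c\, t\, \langle \nabla f(x), v\rangle$$ is satisfied. Thus, for every initial step size $\alpha \in (0,\infty)$, the while loop of the backtracking procedure (starting from step size $\alpha$; while the current step size $a$ satisfies $f(R(x,av)) > f(x) + c\,a\,\langle \nabla f(x), v\rangle$, replace $a$ by $a\beta$) terminates after at most $$\max\left\{0, \left\lceil \frac{\ln(\alpha_*/\alpha)}{\ln(\beta)} \right\rceil\right\}$$ iterations with a final step size $\underline{\alpha}$ at least $\min\{\alpha, \alpha_*\beta\}$.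
   Context: A Euclidean vector space is a finite-dimensional real inner product space. Tangent cone: for $x \in C$, $T_C(x)$ is the set of all $v \in \mathcal{E}$ for which there exist a sequence $(x_i)_{i \in \mathbb{N}}$ in $C$ converging to $x$ and a sequence $(t_i)_{i \in \mathbb{N}}$ in $(0,\infty)$ such that $\left(\frac{x_i-x}{t_i}\right)_{i \in \mathbb{N}}$ converges to $v$. Retraction: a retraction on $C$ is a function $R : \bigcup_{x \in C} \{x\} \times T_C(x) \to C$ such that, for all $x \in C$ and $v \in T_C(x)$, $$\lim_{t \to 0^+} \frac{R(x, tv)-(x+tv)}{t} = 0.$$ (No continuity of $t \mapsto R(x,tv)$ on $[0,\infty)$ is assumed.) B-stationarity: a point $x \in C$ is Bouligand stationary (B-stationary) for $\min_{y \in C} f(y)$ if $\langle \nabla f(x), v\rangle \ge 0$ for all $v \in T_C(x)$. Backtracking retracted line search: given the data $(\mathcal{E}, C, R, f, \beta, c)$ and an input point $x \in C$ that is not B-stationary, the algorithm (1) chooses $v \in T_C(x)$ such that $\langle \nabla f(x), v\rangle < 0$; (2) chooses an initial step size $\alpha \in (0,\infty)$; (3) while $f(R(x,\alpha v)) > f(x) + c\,\alpha\,\langle \nabla f(x), v\rangle$, sets $\alpha \leftarrow \alpha\beta$; (4) returns $R(x,\alpha v)$. In the claim, $\alpha$ denotes the initial step size chosen in step (2) and $\underline{\alpha}$ the step size when the while loop ends. *)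

(* Defs.v *)
From HB Require Import structures.
From mathcomp Require Import all_boot all_order all_algebra.
From mathcomp Require Import all_classical all_reals all_analysis.

Set Implicit Arguments.
Unset Strict Implicit.
Unset Printing Implicit Defensive.

Import Order.TTheory GRing.Theory Num.Theory.
Import numFieldNormedType.Exports.

Local Open Scope classical_set_scope.
Local Open Scope ring_scope.

#[short(type="finNormedModType")]
HB.structure Definition FinNormedModule (R : numFieldType) :=
  {E of NormedModule R E & Vector R E}.

(* A Euclidean vector space is a finite-dimensional normed space [E] with an
   inner product [dot : {dot E for idfun}] (the library's symmetric positive
   definite bilinear forms) that induces the norm, and hence the topology. *)
Definition induces_norm (R : realType) (E : finNormedModType R)
    (dot : {dot E for idfun}) :=
  forall u : E, `|u| = Num.sqrt (dot u u).

Section Stationarity.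
Variables (R : realType) (E : finNormedModType R).
Implicit Types (C : set E) (f : E -> R) (x v : E).

Definition tangent_cone C x : set E :=
  [set v | exists (xs : nat -> E) (ts : nat -> R),
    [/\ forall i, C (xs i),
        xs i @[i --> \oo] --> x,
        forall i, 0 < ts i &
        (ts i)^-1 *: (xs i - x) @[i --> \oo] --> v]].

(* A retraction has domain {(x, v) | x \in C, v \in tangent_cone C x}: it is
   encoded as a total function whose values elsewhere are unconstrained. *)
Definition is_retraction C (Rt : E -> E -> E) :=
  forall x v, C x -> tangent_cone C x v ->
    C (Rt x v) /\ t^-1 *: (Rt x (t *: v) - (x + t *: v)) @[t --> 0^'+] --> 0.

(* The second conjunct is continuity of x |-> 'd f x for the operator norm. *)
Definition continuously_differentiable f :=
  (forall x, differentiable f x) /\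
  (forall x (e : R), 0 < e ->
    \forall y \near x, forall v, `|'d f y v - 'd f x v| <= e * `|v|).

Variable dot : {dot E for idfun}.

(* By [grad_dot] below, the default value 0 is never used. *)
Definition grad f x : E := xget 0 [set g : E | forall v, 'd f x v = dot g v].

Definition b_stationary C f x :=
  C x /\ forall v, tangent_cone C x v -> 0 <= dot (grad f x) v.

Lemma riesz_representation (g : {linear E -> R}) :
  exists u, forall v, g v = dot u v.
Proof.
pose b := vbasis {:E}%VS.
pose L0 u := \sum_(i < \dim {:E}) dot u b`_i *: b`_i : E.
have L0lin : linear L0.
  move=> a u v; rewrite /L0 scaler_sumr -big_split/=.
  by apply: eq_bigr => i _; rewrite linearPl scalerDl scalerA.
pose L0L := GRing.isLinear.Build _ _ _ _ L0 L0lin.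
pose L1 : {linear E -> E} := HB.pack L0 L0L.
pose L := linfun L1.
have LE u : L u = L0 u by rewrite lfunE.
have fb : free b := basis_free (vbasisP _).
have ext (h k : {linear E -> R}) :
    (forall i : 'I_(\dim {:E}), h b`_i = k b`_i) -> h =1 k.
  move=> hk v; have -> := coord_vbasis (memvf v).
  rewrite !linear_sum; apply: eq_bigr => i _.
  by rewrite !linearZ/= hk.
have kerL : lker L == 0%VS.
  apply/lker0P => u v /eqP; rewrite -subr_eq0 -linearB/= => /eqP Luv0.
  apply/eqP; rewrite -subr_eq0; set w := u - v.
  apply: contraT => w0.
  have := @neq0_dnorm_gt0 _ _ _ dot w w0.
  have w0i (i : 'I_(\dim {:E})) : dot w b`_i = 0.
    move: Luv0; rewrite LE /L0 => sum0.
    by have /freeP/(_ (fun i => dot w b`_i) sum0 i) := fb.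
  have -> : dot w w = 0; last by rewrite ltxx.
  rewrite {2}(coord_vbasis (memvf w)) linear_sum/= big1// => i _.
  by rewrite linearZ/= w0i mulr0.
pose u := (L^-1)%VF (\sum_(i < \dim {:E}) g b`_i *: b`_i).
exists u; apply: (ext g (dot u)) => i.
have Lu : L u = \sum_(i < \dim {:E}) g b`_i *: b`_i by rewrite /u lker0_lfunVK.
move: Lu; rewrite LE /L0 => /eqP; rewrite -subr_eq0 -sumrB => /eqP.
under eq_bigr do rewrite -scalerBl.
move=> sum0.
have /freeP/(_ (fun i => dot u b`_i - g b`_i) sum0 i) := fb.
by move/eqP; rewrite subr_eq0 => /eqP.
Qed.

Lemma grad_dot f x v : 'd f x v = dot (grad f x) v.
Proof.
have [g gE] := riesz_representation ('d f x).
exact: (@xgetPex _ 0 [set g : E | forall v, 'd f x v = dot g v]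
  (ex_intro _ g gE)).
Qed.

End Stationarity.

(* [backtracks cond beta a k b]: started from the step size [a], the loop
   "while cond a do a <- a * beta" terminates after exactly [k] iterations,
   with final step size [b]. *)
Inductive backtracks (R : realType) (cond : R -> Prop) (beta : R) :
    R -> nat -> R -> Prop :=
| BacktracksStop a : ~ cond a -> backtracks cond beta a 0 a
| BacktracksStep a k b : cond a -> backtracks cond beta (a * beta) k b ->
    backtracks cond beta a k.+1 b.

(* Main.v *)
(** The retraction gives [R(x, tv) = x + t (v + r(t))] with [r(t) -> 0], so by
    differentiability [f (R(x, tv)) = f x + t <grad f x, v> + o(t)] as
    [t -> 0+]; since [c < 1] and [<grad f x, v> < 0], the Armijo condition holds
    for all small [t > 0]. At [t = 0] it holds because the defining limit at
    the tangent vector [0] forces [R(x, 0) = x]. The loop thus stops as soon as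
    the step size is at most [alphas], and any rejected step size exceeds
    [alphas], so the next one exceeds [alphas * beta]. *)
Require Import Defs.
From HB Require Import structures.
From mathcomp Require Import all_boot all_order all_algebra.
From mathcomp Require Import all_classical all_reals all_analysis.
From mathcomp Require Import lra.

Set Implicit Arguments.
Unset Strict Implicit.
Unset Printing Implicit Defensive.

Import Order.TTheory GRing.Theory Num.Theory.
Import numFieldNormedType.Exports.

Local Open Scope classical_set_scope.
Local Open Scope ring_scope.

(** Induction on [n]: each rejected step replaces [alpha] by [alpha * beta], which absorbs one
    factor of [beta ^+ n]. *)
Lemma backtracks_terminates (R : realType) (cond : R -> Prop)
    (beta alphas : R) (n : nat) (alpha : R) :
    0 < beta < 1 -> (forall a, 0 < a <= alphas -> ~ cond a) ->
    0 < alpha -> alpha * beta ^+ n <= alphas ->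
  exists k b, [/\ backtracks cond beta alpha k b, (k <= n)%N &
                  Num.min alpha (alphas * beta) <= b].
Proof.
move=> /andP[beta0 beta1] accept; elim: n alpha => [|n IHn] alpha alpha0.
  rewrite expr0 mulr1 => le_alpha; exists 0%N, alpha; split => //.
    by apply/BacktracksStop/accept; rewrite alpha0.
  by rewrite ge_min lexx.
rewrite exprS mulrA => le_alpha.
have [cond_alpha|stop] := pselect (cond alpha); last first.
  by exists 0%N, alpha; split; [exact: BacktracksStop| |rewrite ge_min lexx].
have alphas_lt : alphas < alpha.
  rewrite ltNge; apply/negP => alpha_le.
  by apply: (accept alpha) => //; rewrite alpha0.
have [k [b [bt kn le_b]]] := IHn _ (mulr_gt0 alpha0 beta0) le_alpha.
exists k.+1, b; split => //; first exact: BacktracksStep.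
(* As [alphas < alpha], [alphas * beta] is below both entries of the minimum in [le_b]. *)
apply: le_trans le_b.
by rewrite le_min !ge_min lexx ler_pM2r// (ltW alphas_lt) !orbT.
Qed.

(** After taking logarithms the claim is [n * ln beta <= ln (b / a)]; dividing by [ln beta < 0]
    reverses it into a lower bound on [n], which the ceiling meets. *)
Lemma mul_expr_ceil_ln_le (R : realType) (beta a b : R) :
    0 < beta < 1 -> 0 < a -> 0 < b ->
  a * beta ^+ `|Num.max (0 : int) (Num.ceil (ln (b / a) / ln beta))|%N <= b.
Proof.
move=> /andP[beta0 beta1] a0 b0; set m := Num.max _ _; set n := `|m|%N.
have ln_beta : ln beta < 0 by apply: ln_lt0; rewrite beta0.
rewrite mulrC -ler_pdivlMr// -ler_ln ?posrE ?exprn_gt0 ?divr_gt0//.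
rewrite lnXn// -mulr_natl -ler_ndivrMr//.
apply: (le_trans (ceil_ge _)).
by rewrite natr_absz ler_int ger0_norm /m le_max lexx ?orbT.
Qed.

Lemma tangent_cone0 (R : realType) (E : finNormedModType R) (C : set E)
    (x : E) : C x -> tangent_cone C x 0.
Proof.
move=> Cx; exists (fun=> x), (fun=> 1); split => //; first exact: cvg_cst.
by rewrite subrr scaler0; exact: cvg_cst.
Qed.

(** At the zero tangent vector the quotient is [t^-1 *: (Rt x 0 - x)]. Multiplied by [t] it still
    tends to 0, yet it is then constant for [t > 0]. *)
Lemma retraction0 (R : realType) (E : finNormedModType R) (C : set E)
    (Rt : E -> E -> E) (x : E) :
  is_retraction C Rt -> C x -> Rt x 0 = x.
Proof.
move=> /(_ x 0) Rt_retr Cx; have [_] := Rt_retr Cx (tangent_cone0 Cx).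
under eq_fun do rewrite scaler0 addr0.
move=> quot0; apply/eqP; rewrite -subr_eq0.
have id0 : (t : R) @[t --> 0^'+] --> (0 : R).
  exact: cvg_at_right_filter.
have lim0 : t *: (t^-1 *: (Rt x 0 - x)) @[t --> 0^'+] --> (0 : E).
  by rewrite -[X in _ --> X](scale0r 0); exact: cvgZ.
apply/eqP/esym/(norm_cvg_unique lim0).
apply: cvg_near_cst; near=> t.
by rewrite scalerA divff ?scale1r// gt_eqF.
Unshelve. all: by end_near. Qed.

Lemma diff_near (R : realType) (E : normedModType R) (f : E -> R) (x : E)
    (e : R) : differentiable f x -> 0 < e ->
  \forall h \near 0, `|f (x + h) - f x - 'd f x h| <= e * `|h|.
Proof.
move=> df e0; near=> h; rewrite [x + h]addrC (diff_locallyx df).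
rewrite -[f x + _ + _]addrA (addrC (f x)) addrK addrAC subrr add0r.
by near: h; exact: littleoP.
Unshelve. all: by end_near.
Qed.

Lemma retraction_armijo (R : realType) (E : finNormedModType R)
    (C : set E) (Rt : E -> E -> E) (f : E -> R) (c : R) (x v : E) :
    is_retraction C Rt -> C x -> tangent_cone C x v ->
    differentiable f x -> c < 1 -> 'd f x v < 0 ->
  \forall t \near 0^'+, f (Rt x (t *: v)) <= f x + c * t * 'd f x v.
Proof.
move=> Rt_retr Cx Tv df c1 desc.
pose r t := t^-1 *: (Rt x (t *: v) - (x + t *: v)).
have r0 : r t @[t --> 0^'+] --> 0 by have [] := Rt_retr x v Cx Tv.
have id0 : (t : R) @[t --> 0^'+] --> (0 : R) by exact: cvg_at_right_filter.
have w0 : t *: (v + r t) @[t --> 0^'+] --> 0.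
  rewrite -[X in _ --> X](scale0r (v + 0)).
  by apply: cvgZ => //; apply: cvgD => //; exact: cvg_cst.
(* [t * s] is the gap between the Armijo bound and the linear model [f x + t * 'd f x v]. Half of it
   will absorb [t * 'd f x (r t)], the other half the first-order remainder of [f]. *)
pose s := (1 - c) * - 'd f x v.
have s0 : 0 < s by rewrite mulr_gt0 ?subr_gt0 ?oppr_gt0.
(* Chosen so that [e] times [|v| + 1], a bound on the norm of [v + r t] once that of [r t] is at
   most 1, equals [s / 2]. *)
pose e := s / 2 / (`|v| + 1).
have v1 : 0 < `|v| + 1 by rewrite ltr_wpDl.
have e0 : 0 < e by rewrite !divr_gt0.
have dfr0 : 'd f x (r t) @[t --> 0^'+] --> (0 : R).
  rewrite -[X in _ --> X](linear0 ('d f x)).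
  by apply: continuous_cvg r0; exact: diff_continuous.
near=> t.
have t0 : 0 < t by near: t; exact: nbhs_right_gt.
have RtE : Rt x (t *: v) = x + t *: (v + r t).
  by rewrite scalerDr /r scalerA divff ?gt_eqF// scale1r addrA [RHS]addrC subrK.
have rem : `|f (x + t *: (v + r t)) - f x - 'd f x (t *: (v + r t))|
    <= e * `|t *: (v + r t)|.
  by near: t; exact: (w0 _ (diff_near df e0)).
have r1 : `|r t| <= 1.
  by near: t; apply: cvgr0_norm_le.
have dfr : 'd f x (r t) <= s / 2.
  by near: t; apply: cvgr_le dfr0 _ _; rewrite divr_gt0.
have norm_le : `|v + r t| <= `|v| + 1.
  by rewrite (le_trans (ler_normD _ _))// lerD2l.
rewrite RtE.
have {rem}/ler_normlW := rem.
rewrite normrZ gtr0_norm// linearZ/= linearD/=.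
have : e * (t * `|v + r t|) <= t * (s / 2).
  rewrite mulrCA ler_pM2l// (le_trans (ler_wpM2l (ltW e0) norm_le))//.
  by rewrite /e divfK ?gt_eqF.
have : t * 'd f x (r t) <= t * (s / 2) by rewrite ler_pM2l.
rewrite /s /GRing.scale/=; lra.
Unshelve. all: by end_near. Qed.

Theorem proposition4 (R : realType) (E : finNormedModType R)
    (dot : {dot E for idfun}) (dot_norm : induces_norm dot)
    (C : set E) (C0 : C !=set0) (Ccl : closed C)
    (Rt : E -> E -> E) (Rt_retr : is_retraction C Rt)
    (f : E -> R) (fC1 : continuously_differentiable f)
    (beta c : R) (beta01 : 0 < beta < 1) (c01 : 0 < c < 1)
    (x : E) (Cx : C x) (x_nstat : ~ b_stationary dot C f x)
    (v : E) (Tv : tangent_cone C x v) (v_desc : dot (grad dot f x) v < 0) :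
  exists alphas : R,
    [/\ 0 < alphas,
        forall t, 0 <= t <= alphas ->
          f (Rt x (t *: v)) <= f x + c * t * dot (grad dot f x) v &
        forall alpha, 0 < alpha ->
          exists (k : nat) (alphabar : R),
            [/\ backtracks
                  (fun a =>
                    f (Rt x (a *: v)) > f x + c * a * dot (grad dot f x) v)
                  beta alpha k alphabar,
                (k%:Z <= Num.max 0 (Num.ceil (ln (alphas / alpha) / ln beta))) &
                Num.min alpha (alphas * beta) <= alphabar]].
Proof.
have [Dfx _] := fC1; move/andP: c01 => [_ c1].
have armijo0 := retraction_armijo Rt_retr Cx Tv (Dfx x) c1.
rewrite (grad_dot dot) in armijo0.
have [d /= d0 near_armijo] := armijo0 v_desc.
(* The Armijo condition is known on the open interval from 0 to [d]: halving [d] gives a closed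
   right end, and [t = 0] is treated separately. *)
have armijo t : 0 <= t <= d / 2 ->
    f (Rt x (t *: v)) <= f x + c * t * dot (grad dot f x) v.
  rewrite le_eqVlt => /andP[/predU1P[<- _|t0 td]].
    by rewrite scale0r (retraction0 Rt_retr Cx) mulr0 mul0r addr0.
  apply: near_armijo => //=.
  by rewrite sub0r normrN gtr0_norm//; apply: le_lt_trans td _; lra.
exists (d / 2); split => //; first by rewrite divr_gt0.
move=> alpha alpha0.
have d20 : 0 < d / 2 by rewrite divr_gt0.
have [|k [b [bt kn le_b]]] := backtracks_terminates
  (cond := fun a => f (Rt x (a *: v)) > f x + c * a * dot (grad dot f x) v)
  beta01 _ alpha0 (mul_expr_ceil_ln_le beta01 alpha0 d20).
  move=> a /andP[a0 ad]; apply/negP; rewrite -leNgt.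
  by apply: armijo; rewrite ltW.
exists k, b; split => //.
(* [kn] bounds [k] by the absolute value of the maximum, which is the maximum itself since it is
   nonnegative. *)
by rewrite -[leRHS]gez0_abs ?lez_nat// le_max lexx.
Qed.
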